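(* Let $G$ be a loopless graph. Then the neighbourhood-set system $(V(G),\mathcal{N}(G))$ of $G$ is a well-graded family if and only if $G$ is either a nonempty set of isolated vertices or a union of some disjoint half-graphs and a nonempty set of isolated vertices.
   Context: Graphs are finite, undirected, with nonempty vertex set and no multiple edges. For a vertex $v$ of $G$, $N_G(v)$ is the set of vertices adjacent to $v$, and $\mathcal{N}(G)=\{N_G(v):v\in V(G)\}$ (a set of subsets of $V(G)$, without multiplicities). An isolated vertex is a vertex of degree $0$. A set system $(X,\mathcal{F})$ is a finite set $X$ with a nonempty family $\mathcal{F}$ of distinct subsets of $X$. Its one-inclusion graph $G_{\mathcal{F}}$ has a vertex $v_A$ for each $A\in\mathcal{F}$, with an edge (directed from $v_A$ to $v_B$, labelled $b$) whenever $B=A\cup\{b\}$ for some $b\in X\setminus A$. The system is well-graded if for all $A,B\in\mathcal{F}$ the distance between $v_A$ and $v_B$ in the underlying undirected graph of $G_{\mathcal{F}}$ equals $|A\triangle B|$ (the distance being infinite if there is no path). The half-graph of order $n\ge 1$ is a bipartite graph with parts $\{a_1,\dots,a_n\}$ and $\{b_1,\dots,b_n\}$ such that either for all $1\le i,j\le n$, $a_i$ is adjacent to $b_j$ iff $i\le j$, or for all $1\le i,j\le n$, $a_i$ is adjacent to $b_j$ iff $i\ge j$. A ''union of disjoint half-graphs and isolated vertices'' is a disjoint union, with no edges between different pieces; the half-graphs may have different orders. *)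

(* Defs.v *)
From mathcomp Require Import all_boot.

Set Implicit Arguments.
Unset Strict Implicit.
Unset Printing Implicit Defensive.

(* A graph is a symmetric relation on a nonempty finType of vertices; a set
   system on T is a nonempty F : {set {set T}}. *)

Section Distance.
Variables (V : finType) (r : rel V).

(* When no path joins x to y the distance is infinite, and no n satisfies
   is_distance x y n. *)
Definition is_distance (x y : V) (n : nat) : Prop :=
  (exists p : seq V, [/\ path r x p, last x p = y & size p = n]) /\
  (forall p : seq V, path r x p -> last x p = y -> n <= size p).

End Distance.

Section SetSystems.
Variables (T : finType) (F : {set {set T}}).

(* The vertices v_A are represented by the sets A in F themselves; sets outside
   F are incident to no edge, so that paths starting in F stay in F. *)
Definition one_inclusion_arc (A B : {set T}) (b : T) : bool :=
  [&& A \in F, B \in F, b \notin A & B == b |: A].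

Definition one_inclusion_graph : rel {set T} :=
  [rel A B | [exists b, one_inclusion_arc A B b]
          || [exists b, one_inclusion_arc B A b]].

Definition symdiff (A B : {set T}) : {set T} := (A :\: B) :|: (B :\: A).

Definition well_graded : Prop :=
  forall A B : {set T}, A \in F -> B \in F ->
    is_distance one_inclusion_graph A B #|symdiff A B|.

End SetSystems.

Section Graphs.
Variables (T : finType) (e : rel T).

Definition nbhd (v : T) : {set T} := [set w | e v w].

Definition nbhd_system : {set {set T}} := [set nbhd v | v in T].

Definition isolated (v : T) : bool := #|nbhd v| == 0.

Definition nonempty_set_of_isolated (S : {set T}) : Prop :=
  S != set0 /\ (forall v, v \in S -> isolated v).

(* The subgraph induced on S is a half-graph of order n. *)
Definition half_graph_of_order (n : nat) (S : {set T}) : Prop :=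
  exists a b : 'I_n -> T,
    [/\ injective a /\ injective b,
        (forall i j, a i != b j),
        S = [set a i | i in 'I_n] :|: [set b j | j in 'I_n],
        (forall i j, ~~ e (a i) (a j)) /\ (forall i j, ~~ e (b i) (b j))
      & (forall i j : 'I_n, e (a i) (b j) = (i <= j)) \/
        (forall i j : 'I_n, e (a i) (b j) = (i >= j))].

Definition half_graph (S : {set T}) : Prop :=
  exists n : nat, 1 <= n /\ half_graph_of_order n S.

Definition union_of_half_graphs_and_isolated : Prop :=
  exists (P : {set {set T}}) (I : {set T}),
    [/\ partition P (~: I) /\ P != set0,
        (forall S, S \in P -> half_graph S),
        (forall S S', S \in P -> S' \in P -> S != S' ->
           forall x y, x \in S -> y \in S' -> ~~ e x y)
      & nonempty_set_of_isolated I].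

End Graphs.

(* Main.v *)
(** Both sides are equivalent to: every non-isolated vertex x is the label of an
    arc N(z) -> N(z') = N(z) + x of the one-inclusion graph.  Such a z' is again
    non-isolated, hence a label itself, and any arc labelled z' must end at
    N(x); so x |-> z' is an involution x |-> x', and N(x) - x' is a
    neighbourhood for every x.  Induction along these arcs gives: x ~ y implies
    N(x') <= N(y), and neighbourhoods sharing an element are nested.  Hence
    "N(x) meets N(y)" is an equivalence relation on the non-isolated vertices;
    ordering a class by inclusion of neighbourhoods as b_1, ..., b_n, the class
    together with a_i = b_i' is a half-graph.  Isometry of the one-inclusion
    graph follows too: N(y) is reached from N(x) <= N(y) by adding labels one at
    a time, and disjoint neighbourhoods are joined through the empty set. *)
Require Import Defs.
From mathcomp Require Import all_boot.

Set Implicit Arguments.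
Unset Strict Implicit.
Unset Printing Implicit Defensive.

(** * Walks of a given length *)

Section Walks.
Variables (V : finType) (r : rel V).

(** The existence half of [is_distance]. *)
Definition walk (x y : V) (n : nat) : Prop :=
  exists p : seq V, [/\ path r x p, last x p = y & size p = n].

Lemma walk_cat x y z m n : walk x y m -> walk y z n -> walk x z (m + n).
Proof.
move=> [p [Hp <- <-]] [q [Hq <- <-]]; exists (p ++ q).
by rewrite cat_path Hp Hq last_cat size_cat.
Qed.

Lemma walk_sym x y n : symmetric r -> walk x y n -> walk y x n.
Proof.
move=> r_sym [p [Hp <- <-]]; exists (rev (belast x p)); split.
- by rewrite rev_path (eq_path (e' := r)) // => u v; rewrite /= r_sym.
- by case: p {Hp} => //= y' p; rewrite rev_cons last_rcons.
- by rewrite size_rev size_belast.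
Qed.

End Walks.

(** * Symmetric differences and walks in a one-inclusion graph *)

Section OneInclusion.
Variables (T : finType) (F : {set {set T}}).
Implicit Types A B C : {set T}.

Lemma one_inclusion_graph_sym : symmetric (one_inclusion_graph F).
Proof. by move=> A B; rewrite /one_inclusion_graph /= orbC. Qed.

Lemma one_inclusion_graphP A B :
  reflect (exists b, one_inclusion_arc F A B b \/ one_inclusion_arc F B A b)
          (one_inclusion_graph F A B).
Proof.
apply: (iffP orP) => [[]/existsP[b Hb] | [b []Hb]].
- by exists b; left.
- by exists b; right.
- by left; apply/existsP; exists b.
- by right; apply/existsP; exists b.
Qed.

Lemma symdiffxx A : symdiff A A = set0.
Proof. by rewrite /symdiff setDv setU0. Qed.

Lemma symdiffC A B : symdiff A B = symdiff B A.
Proof. by rewrite /symdiff setUC. Qed.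

Lemma symdiff_sub A B : A \subset B -> symdiff A B = B :\: A.
Proof. by rewrite /symdiff -setD_eq0 => /eqP->; rewrite set0U. Qed.

Lemma symdiff_disjoint A B : A :&: B = set0 -> symdiff A B = A :|: B.
Proof.
move=> /setP AB0; apply/setP=> x; move: (AB0 x); rewrite !inE.
by case: (x \in A); case: (x \in B).
Qed.

Lemma symdiff_triangle A B C :
  symdiff A C \subset symdiff A B :|: symdiff B C.
Proof.
by apply/subsetP=> x; rewrite !inE; case: (x \in A); case: (x \in B);
  case: (x \in C).
Qed.

Lemma card_symdiff_arc A B b : one_inclusion_arc F A B b -> #|symdiff A B| = 1.
Proof.
case/and4P=> _ _ bA /eqP->; rewrite symdiff_sub ?subsetUr //.
by rewrite setDUl setDv setU0 (setDidPl _) ?cards1 // disjoints1.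
Qed.

Lemma card_symdiff_path A p :
  path (one_inclusion_graph F) A p -> #|symdiff A (last A p)| <= size p.
Proof.
elim: p A => [|B p IHp] A; first by rewrite /= symdiffxx cards0.
rewrite [path _ _ _]/= => /andP[/one_inclusion_graphP[b AB] /IHp Hp].
rewrite [last _ _]/= [size _]/=.
apply: leq_trans (subset_leq_card (symdiff_triangle A B _)) _.
apply: leq_trans (leq_card_setU _ _) _; rewrite -add1n leq_add //.
by case: AB => /card_symdiff_arc; rewrite 1?symdiffC => ->.
Qed.

(** The walk must lose [x] at some edge; the larger end of that edge serves as [C]. *)
Lemma walk_label A B n x : walk (one_inclusion_graph F) A B n ->
  x \in A -> x \notin B -> exists C, [/\ C \in F, x \in C & C :\ x \in F].
Proof.
case=> p [Hp <- _] {n B}; elim: p A Hp => [|B p IHp] A; first by move=> _ /= ->.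
rewrite [path _ _ _]/= [last _ _]/= => /andP[/one_inclusion_graphP[b AB] Hp] xA.
have [xB|xB] := boolP (x \in B); first exact: IHp.
move=> _; case: AB => /and4P[H1 H2 H3 /eqP H4].
  by rewrite H4 inE xA orbT in xB.
have bx : x = b by move: xA; rewrite H4 !inE (negPf xB) orbF => /eqP.
by exists A; split=> //; rewrite H4 bx setU1K.
Qed.

End OneInclusion.

(** * Labels of arcs between neighbourhoods *)

Section Graph.
Variables (T : finType) (e : rel T).
Hypotheses (e_sym : symmetric e) (e_irr : irreflexive e).

Local Notation N := (nbhd e).
Local Notation NS := (nbhd_system e).

Lemma in_nbhd x y : (y \in N x) = e x y.
Proof. by rewrite inE. Qed.

Lemma nbhd_in_system x : N x \in NS.
Proof. exact: imset_f. Qed.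

Lemma isolatedPn x : reflect (exists y, e x y) (~~ isolated e x).
Proof.
rewrite /isolated cards_eq0.
by apply: (iffP (set0Pn _)) => -[y]; rewrite ?inE => xy; exists y; rewrite ?inE.
Qed.

Lemma adj_nonisolated x y : e x y -> ~~ isolated e x.
Proof. by move=> xy; apply/isolatedPn; exists y. Qed.

(* [y] labels an arc of the one-inclusion graph ending at [N x]. *)
Definition in_label (x y : T) : bool := e x y && (N x :\ y \in NS).

(** If [z != y], then [z] stays in [N u = N x :\ y], so [u] is in [N z], differs from [x], and lies
    in [N t = N z :\ x]. Then [t] is in [N u], hence in [N x], which puts [x] in [N t]: a
    contradiction. *)
Lemma in_label_inj x y z : in_label x y -> in_label z x -> y = z.
Proof.
move=> /andP[xy /imsetP[u _ Hu]] /andP[zx /imsetP[t _ Ht]].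
have Eu v : e u v = (v != y) && e x v by rewrite -in_nbhd -Hu !inE.
have Et v : e t v = (v != x) && e z v by rewrite -in_nbhd -Ht !inE.
apply/eqP; apply: contraT; rewrite eq_sym => zy.
have uz : e u z by rewrite Eu zy e_sym.
have ux : u != x by apply: contraTneq xy => <-; rewrite Eu eqxx.
have tu : e t u by rewrite Et ux e_sym.
have tx : e t x by move: tu; rewrite e_sym Eu e_sym => /andP[].
by rewrite Et eqxx in tx.
Qed.

Definition all_labelled : Prop :=
  forall x, ~~ isolated e x -> exists y, in_label y x.

(** For [y] adjacent to [x], the absence of loops puts [x] in [N y] but not in [N x], so a walk from
    the first to the second loses [x]. *)
Lemma well_graded_labelled : well_graded NS -> all_labelled.
Proof.
move=> wg x /isolatedPn[y xy].
have [w _] := wg _ _ (nbhd_in_system y) (nbhd_in_system x).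
have [||C [/imsetP[z _ ->] xz zx]] := walk_label w (x := x).
- by rewrite inE e_sym.
- by rewrite inE e_irr.
by exists z; rewrite /in_label -in_nbhd xz.
Qed.

(** * The involution [mate] and the nesting of neighbourhoods *)

Section Labelled.
Hypothesis labelled : all_labelled.

(** The vertex x' of the overview; the default [x] is returned exactly at isolated vertices. *)
Definition mate (x : T) : T := odflt x [pick y | in_label y x].

Lemma mate_label x : ~~ isolated e x -> in_label (mate x) x.
Proof.
rewrite /mate; case: pickP => //= no_label /labelled[y].
by rewrite no_label.
Qed.

Lemma adj_mate x : ~~ isolated e x -> e x (mate x).
Proof. by move/mate_label/andP=> []; rewrite e_sym. Qed.

Lemma mate_nonisolated x : ~~ isolated e x -> ~~ isolated e (mate x).
Proof. by move/adj_mate; rewrite e_sym => /adj_nonisolated. Qed.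

Lemma mateK x : ~~ isolated e x -> mate (mate x) = x.
Proof.
move=> xI; apply/esym/in_label_inj; first exact: mate_label xI.
exact/mate_label/mate_nonisolated.
Qed.

(** As [mate (mate x) = x], the arc labelled [mate x] ends at [N x]. Its source is the smaller
    neighbourhood to which the inductions on size descend. *)
Lemma nbhd_pred x : ~~ isolated e x ->
  exists u, [/\ N u = N x :\ mate x, N u \subset N x & #|N u| < #|N x|].
Proof.
move=> xI; have:= mate_label (mate_nonisolated xI).
rewrite mateK // => /andP[xm /imsetP[u _ Hu]]; exists u; rewrite -Hu.
by rewrite subsetDl [ltnRHS](cardsD1 (mate x)) in_nbhd xm.
Qed.

Lemma adj_pred x u y : N u = N x :\ mate x -> e x y -> y != mate x -> e u y.
Proof. by move=> Hu xy ym; rewrite -in_nbhd Hu !inE ym. Qed.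

Lemma exists_isolated : 0 < #|T| -> exists x, isolated e x.
Proof.
case/card_gt0P=> x _; have [n] := ubnP #|N x|.
elim: n x => // n IHn x /ltnSE xn.
have [|/nbhd_pred[u [_ _ ux]]] := boolP (isolated e x); first by exists x.
exact/IHn/(leq_trans ux).
Qed.

(** Descend from [N y], which loses [mate y]: as long as [x] is another element, it stays in the
    smaller neighbourhood; once [x] is [mate y], its mate is [y]. *)
Lemma nbhd_mate_sub x y : e x y -> N (mate x) \subset N y.
Proof.
have [n] := ubnP #|N y|; elim: n x y => // n IHn x y /ltnSE yn xy.
have yx : e y x by rewrite e_sym.
have yI := adj_nonisolated yx.
have [u [Hu uy uyc]] := nbhd_pred yI.
have [-> | xm] := eqVneq x (mate y); first by rewrite mateK.
apply: subset_trans uy; apply: IHn; first exact: leq_trans yn.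
by rewrite e_sym; apply: adj_pred yx xm.
Qed.

(** [x] lies in [N (mate x)], so it is adjacent to [mate y], and [nbhd_mate_sub] applies. *)
Lemma sub_nbhd_mate x y : ~~ isolated e x -> ~~ isolated e y ->
  N (mate x) \subset N (mate y) -> N y \subset N x.
Proof.
move=> xI yI /subsetP/(_ x); rewrite !in_nbhd ![e (mate _) x]e_sym adj_mate //.
by move/(_ isT); rewrite e_sym => /nbhd_mate_sub; rewrite mateK.
Qed.

(** Descend from [N x] until the lost element [mate x] is [y] or [z]. If it is [y], then
    [mate y = x] and [N (mate z)] lies inside [N x]; likewise for [z]. *)
Lemma nbhd_mate_nested x y z : e x y -> e x z ->
  (N (mate y) \subset N (mate z)) || (N (mate z) \subset N (mate y)).
Proof.
have [n] := ubnP #|N x|; elim: n x => // n IHn x /ltnSE xn xy xz.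
have xI := adj_nonisolated xy.
have [u [Hu _ ux]] := nbhd_pred xI.
have [->|ym] := eqVneq y (mate x).
  by rewrite mateK // (nbhd_mate_sub (x := z)) ?orbT // e_sym.
have [->|zm] := eqVneq z (mate x).
  by rewrite mateK // (nbhd_mate_sub (x := y)) // e_sym.
apply: (IHn u); first exact: leq_trans xn.
  exact: adj_pred Hu xy ym.
exact: adj_pred Hu xz zm.
Qed.

Lemma nbhd_nested x y z : e x y -> e x z ->
  (N y \subset N z) || (N z \subset N y).
Proof.
move=> xy xz.
have yI : ~~ isolated e y by apply: (@adj_nonisolated _ x); rewrite e_sym.
have zI : ~~ isolated e z by apply: (@adj_nonisolated _ x); rewrite e_sym.
by have /orP[/sub_nbhd_mate->|/sub_nbhd_mate->] := nbhd_mate_nested xy xz;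
  rewrite ?orbT.
Qed.

(** * Isometry of the one-inclusion graph *)

Lemma walk_down A B : A \in NS -> B \in NS -> A \subset B ->
  walk (one_inclusion_graph NS) B A #|B :\: A|.
Proof.
move=> AN; move En: #|_| => n; elim: n B En => [|n IHn] B En BN AB.
  exists [::]; split=> //=; apply/eqP; rewrite eqEsubset AB.
  by rewrite -setD_eq0 -cards_eq0 En.
have /card_gt0P[y] : 0 < #|B :\: A| by rewrite En.
rewrite inE => /andP[yA yB].
case/imsetP: (BN) => w _ Bw; case/imsetP: (AN) => v _ Av.
have wI : ~~ isolated e w by apply: (@adj_nonisolated _ y); rewrite -in_nbhd -Bw.
have [u [Hu _ _]] := nbhd_pred wI.
have mB : mate w \in B by rewrite Bw in_nbhd adj_mate.
(* Otherwise [nbhd_mate_sub] would put [B = N w] inside [A = N v], although [y] is in [B] and not in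
   [A]. *)
have mA : mate w \notin A.
  apply: contra yA; rewrite Av in_nbhd e_sym => /nbhd_mate_sub.
  by rewrite mateK // -Bw => /subsetP->.
rewrite -add1n; apply: walk_cat (IHn (N u) _ (nbhd_in_system u) _).
- exists [:: N u]; split=> //; rewrite [path _ _ _]/= andbT.
  apply/one_inclusion_graphP.
  exists (mate w); right; rewrite /one_inclusion_arc nbhd_in_system BN Hu -Bw.
  by rewrite setD1K // setD11 eqxx.
- apply: succn_inj; rewrite -En (cardsD1 (mate w) (B :\: A)) inE mA mB add1n.
  by rewrite Hu -Bw !setDDl setUC.
- by rewrite Hu -Bw subsetD1 AB.
Qed.

Lemma labelled_well_graded : 0 < #|T| -> well_graded NS.
Proof.
move=> T0 A B AN BN; split; last by move=> p Hp <-; apply: card_symdiff_path Hp.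
have rev C D n : walk (one_inclusion_graph NS) C D n ->
    walk (one_inclusion_graph NS) D C n.
  exact/walk_sym/one_inclusion_graph_sym.
have nested C D : C \in NS -> D \in NS -> C \subset D ->
    walk (one_inclusion_graph NS) C D #|symdiff C D|.
  by move=> CN DN CD; rewrite symdiff_sub //; apply/rev/walk_down.
have [AB0|/set0Pn[x]] := eqVneq (A :&: B) set0; last first.
  (* [A] and [B] are the neighbourhoods of two neighbours of [x], hence nested. *)
  case/imsetP: (AN) (BN) => v _ Av /imsetP[w _ Bw].
  rewrite Av Bw !inE ![e _ x]e_sym => /andP[xv xw].
  have := nbhd_nested xv xw; rewrite -Av -Bw => /orP[AB|BA].
    exact: nested.
  by rewrite symdiffC; apply/rev/nested.
have [x /eqP/cards0_eq x0] := exists_isolated T0.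
have N0 : set0 \in NS by rewrite -x0 nbhd_in_system.
have -> : #|symdiff A B| = #|A :\: set0| + #|B :\: set0|.
  by rewrite symdiff_disjoint // cardsU AB0 cards0 subn0 !setD0.
apply: (walk_cat (y := set0)); last apply: rev.
  exact: walk_down N0 AN (sub0set _).
exact: walk_down N0 BN (sub0set _).
Qed.

(** * Sharing a neighbour, an equivalence on non-isolated vertices *)

Definition meet (x y : T) : bool := N x :&: N y != set0.

Lemma meetP x y : reflect (exists z, e z x /\ e z y) (meet x y).
Proof.
apply: (iffP (set0Pn _)) => -[z].
  by rewrite !inE ![e _ z]e_sym => /andP; exists z.
by case=> zx zy; exists z; rewrite !inE ![e _ z]e_sym zx.
Qed.

Lemma meet_sym x y : meet x y = meet y x.
Proof. by rewrite /meet setIC. Qed.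

Lemma meet_refl x : ~~ isolated e x -> meet x x.
Proof. by rewrite /meet setIid /isolated cards_eq0. Qed.

Lemma meet_nested x y : meet x y -> (N x \subset N y) || (N y \subset N x).
Proof. by case/meetP=> z [zx zy]; apply: nbhd_nested zx zy. Qed.

(** The neighbourhoods are nested, so an edge would produce a loop. *)
Lemma meet_nadj x y : meet x y -> ~~ e x y.
Proof.
move/meet_nested/orP=> [] /subsetP sub; apply/negP=> xy.
  by have:= sub y; rewrite !in_nbhd xy e_irr => /(_ isT).
by have:= sub x; rewrite !in_nbhd e_sym xy e_irr => /(_ isT).
Qed.

(** The common neighbours [s] and [t] both lie in [N y], so [N (mate s)] and [N (mate t)] are
    nested. If the first is the smaller, [s] is in [N (mate t)], hence in [N z]; otherwise [t] is in
    [N x]. *)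
Lemma meet_trans x y z : meet x y -> meet y z -> meet x z.
Proof.
case/meetP=> s [sx sy] /meetP[t [ty tz]].
have [ys yt] : e y s /\ e y t by rewrite ![e y _]e_sym.
have own v w : e v w -> v \in N (mate v).
  by move/adj_nonisolated/adj_mate; rewrite inE e_sym.
apply/meetP; case/orP: (nbhd_mate_nested ys yt) => sub; [exists s|exists t].
- split=> //; have /subsetP/(_ s) := subset_trans sub (nbhd_mate_sub tz).
  by rewrite (own _ _ sx) in_nbhd e_sym => ->.
- split=> //; have /subsetP/(_ t) := subset_trans sub (nbhd_mate_sub sx).
  by rewrite (own _ _ ty) in_nbhd e_sym => ->.
Qed.

Lemma adj_meet x y : e x y -> meet (mate x) y.
Proof.
move=> xy; have xI := adj_nonisolated xy.
by apply/meetP; exists x; rewrite adj_mate.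
Qed.

(** This turns the inclusion order of a [meet] class into the adjacency of a half-graph. *)
Lemma adj_mateE x y : ~~ isolated e x -> e (mate x) y = (N x \subset N y).
Proof.
move=> xI; apply/idP/idP => [/nbhd_mate_sub|/subsetP/(_ (mate x))].
  by rewrite mateK.
by rewrite !in_nbhd adj_mate // e_sym => ->.
Qed.

(** When [N x] is the smaller neighbourhood, [y] is adjacent to both mates. *)
Lemma meet_mate x y : ~~ isolated e x -> ~~ isolated e y ->
  meet x y -> meet (mate x) (mate y).
Proof.
wlog sub : x y / N x \subset N y => [wl|] xI yI xy.
  case/orP: (meet_nested xy) => sub; first exact: wl.
  by rewrite meet_sym; apply: wl => //; rewrite meet_sym.
rewrite -adj_mateE // in sub.
by apply/meetP; exists y; rewrite e_sym sub adj_mate.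
Qed.

Lemma mate_nmeet x y : ~~ isolated e x -> meet x y -> mate x != y.
Proof. by move=> xI /meet_nadj; apply: contraNneq => <-; apply: adj_mate. Qed.

(** Let [N u] be [N (mate x)] without [x]. If [y != x], then [y] is in [N (mate x)] and so in [N u];
    thus [u] is in [N y = N x], and [x] is in [N u]. *)
Lemma nbhd_inj x y : ~~ isolated e x -> N x = N y -> x = y.
Proof.
move=> xI Hxy; have /nbhd_pred[u [Hu _ _]] := mate_nonisolated xI.
apply/eqP; apply: contraT; rewrite eq_sym -{1}(mateK xI) => ym.
have: e u y by apply: adj_pred Hu _ ym; rewrite adj_mateE // Hxy.
rewrite e_sym -in_nbhd -Hxy in_nbhd e_sym -in_nbhd Hu.
by rewrite !inE mateK // eqxx.
Qed.

(** * Pieces and their half-graph structure *)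

(** The two [meet] classes, of [x] and of [mate x], become the two sides of a half-graph. *)
Definition piece (x y : T) : bool := meet x y || meet (mate x) y.

(** By [meet_mate] and [mateK], [mate] acts on the [meet] classes as an involution. *)
Lemma piece_equiv : {in ~: [set x | isolated e x] & &, equivalence_rel piece}.
Proof.
have piece_sym x y : ~~ isolated e x -> ~~ isolated e y -> piece x y -> piece y x.
  move=> xI yI /orP[xy|xy]; apply/orP; first by left; rewrite meet_sym.
  right; rewrite meet_sym -(mateK xI); apply: meet_mate => //.
  exact: mate_nonisolated.
have piece_trans x y z : ~~ isolated e x -> ~~ isolated e y -> piece x y ->
    piece y z -> piece x z.
  move=> xI yI /orP[]xy /orP[]yz; apply/orP.
  - by left; apply: meet_trans xy yz.
  - by right; apply: meet_trans yz; apply: meet_mate.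
  - by right; apply: meet_trans xy yz.
  - left; rewrite -(mateK xI); apply: meet_trans yz; apply: meet_mate => //.
    exact: mate_nonisolated.
move=> x y z; rewrite !inE => xI yI zI; split; first by rewrite /piece meet_refl.
move=> xy; apply/idP/idP; last exact: piece_trans.
exact/piece_trans/piece_sym.
Qed.

Lemma piece_half_graph x : ~~ isolated e x ->
  half_graph e [set y | ~~ isolated e y & piece x y].
Proof.
move=> xI; pose C := [set y | meet x y].
have CI y : y \in C -> ~~ isolated e y.
  by rewrite inE => /meetP[z [_]]; rewrite e_sym => /adj_nonisolated.
have Cmeet y z : y \in C -> z \in C -> meet y z.
  by rewrite !inE meet_sym => xy; apply: meet_trans.
(* Neighbourhoods are nested within [C], so sorting by size sorts by inclusion; [nbhd_inj] makes the
   order strict. *)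
pose f y := #|N y|; pose s := sort (relpre f leq) (enum C).
have s_size : size s = #|C| by rewrite size_sort -cardE.
have s_uniq : uniq s by rewrite sort_uniq enum_uniq.
have s_mem y : (y \in s) = (y \in C) by rewrite mem_sort mem_enum.
pose b (i : 'I_#|C|) := nth x s i.
have bC i : b i \in C by rewrite -s_mem mem_nth // s_size.
have b_inj : injective b.
  move=> i j /eqP; rewrite nth_uniq ?s_size // => /eqP; exact: val_inj.
have b_sub i j : (N (b i) \subset N (b j)) = (i <= j).
  have le (k l : 'I_#|C|) : k <= l -> f (b k) <= f (b l).
    have s_sorted : sorted (relpre f leq) s.
      by apply: sort_sorted => u v; apply: leq_total.
    move=> kl; apply: (sorted_leq_nth _ _ x s_sorted); rewrite ?inE ?s_size //.
      by move=> u v w /=; apply: leq_trans.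
    by move=> u /=.
  have le_sub (k l : 'I_#|C|) : k <= l -> N (b k) \subset N (b l).
    move=> kl; case/orP: (meet_nested (Cmeet _ _ (bC k) (bC l))) => // lk.
    by have/eqP<- : N (b l) == N (b k) by rewrite eqEcard lk le.
  apply/idP/idP => [ij|]; last exact: le_sub.
  have [//|ji] := leqP i j.
  have Nij : N (b i) = N (b j).
    by apply/eqP; rewrite eqEsubset ij le_sub // ltnW.
  by rewrite (b_inj _ _ (nbhd_inj (CI _ (bC i)) Nij)) ltnn in ji.
have bI i := CI _ (bC i).
exists #|C|; split; first by apply/card_gt0P; exists x; rewrite inE meet_refl.
exists (mate \o b), b; split.
- split=> // i j /= Hij; apply: b_inj.
  by rewrite -(mateK (bI i)) Hij mateK.
- by move=> i j; apply: mate_nmeet (Cmeet _ _ _ _).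
- have b_img y : (y \in [set b i | i in 'I_#|C|]) = (y \in C).
    apply/imsetP/idP => [[i _ ->] //|yC].
    have ys : index y s < #|C| by rewrite -s_size index_mem s_mem.
    by exists (Ordinal ys); rewrite // /b nth_index // s_mem.
  apply/setP=> y; rewrite in_setU b_img !inE; apply/andP/orP => [[yI]|[]].
  + case/orP=> [|xy]; [by right | left].
    (* As [y] meets [mate x], its mate meets [x] and is some [b i]; so [y] is [mate (b i)]. *)
    have /imsetP[i _ Hi]: mate y \in [set b i | i in 'I_#|C|].
      rewrite b_img inE -(mateK xI).
      by apply: meet_mate => //; apply: mate_nonisolated.
    by apply/imsetP; exists i; rewrite //= -Hi mateK.
  + case/imsetP=> i _ ->; split; first exact: mate_nonisolated.
    by apply/orP; right; apply: meet_mate => //; have:= bC i; rewrite inE.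
  + by move=> xy; rewrite /piece xy; split=> //; apply: CI; rewrite inE.
- by split=> i j; apply: meet_nadj; [apply: meet_mate => //|]; apply: Cmeet.
- by left=> i j; rewrite adj_mateE.
Qed.

Lemma labelled_union : 0 < #|T| -> nonempty_set_of_isolated e [set: T] \/
  union_of_half_graphs_and_isolated e.
Proof.
move=> T0; pose I := [set x | isolated e x].
have [IT|] := eqVneq (~: I) set0.
  left; split; first by rewrite -card_gt0 cardsT.
  by move=> v _; have/setP/(_ v) := IT; rewrite !inE => /negbFE.
case/set0Pn=> x0 x0I; right; exists (equivalence_partition piece (~: I)), I.
have part := equivalence_partitionP piece_equiv.
split.
- split=> //; apply/set0Pn; eexists; apply: imset_f x0I.
- move=> S /imsetP[x]; rewrite !inE => xI ->.
  have -> : [set y in ~: I | piece x y] = [set y | ~~ isolated e y & piece x y].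
    by apply/setP=> y; rewrite !inE.
  exact: piece_half_graph.
- move=> S S' SP SP' SS' x y xS yS'; apply: contra SS' => xy.
  have xI := adj_nonisolated xy.
  have yI : ~~ isolated e y by apply: (adj_nonisolated (y := x)); rewrite e_sym.
  have [_ tI _] := and3P part.
  (* [mate x] and [y] share the neighbour [x], so an edge never leaves its piece. *)
  have xy' : y \in pblock (equivalence_partition piece (~: I)) x.
    rewrite (pblock_equivalence_partition piece_equiv) ?inE //.
    by rewrite /piece adj_meet ?orbT.
  have <- := def_pblock tI SP xS; have <- := def_pblock tI SP' yS'.
  by rewrite (same_pblock tI xy').
- split; last by move=> v; rewrite inE.
  by have [x xI] := exists_isolated T0; apply/set0Pn; exists x; rewrite inE.
Qed.

End Labelled.

(** * From half-graphs back to labels *)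

(** In the first orientation [N (b k)] consists of the [a i] with [i <= k]; removing [a k] leaves
    the neighbourhood of the preceding [b], or [set0] when [k] is 0. *)
Lemma half_graph_label n (a b : 'I_n -> T) (k : 'I_n) :
    set0 \in NS -> injective a ->
    (forall j y, e (b j) y -> exists i, y = a i) ->
    (forall i j : 'I_n, e (a i) (b j) = (i <= j)) \/
    (forall i j : 'I_n, e (a i) (b j) = (i >= j)) ->
  exists y, in_label y (a k).
Proof.
move=> N0; wlog ab : a b k / forall i j : 'I_n, e (a i) (b j) = (i <= j).
  move=> wl a_inj bN [ab|ab]; first by apply: (wl a b) => //; left.
  (* Reversing both indexings turns the second orientation into the first. *)
  have ab' (i j : 'I_n) : e (a (rev_ord i)) (b (rev_ord j)) = (i <= j).
    by rewrite ab leq_sub2lE.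
  rewrite -(rev_ordK k).
  apply: (wl (a \o @rev_ord n) (b \o @rev_ord n)) => //; last by left.
    exact: inj_comp a_inj rev_ord_inj.
  by move=> j y /bN[i ->]; exists (rev_ord i); rewrite /= rev_ordK.
move=> a_inj bN _; exists (b k); rewrite /in_label e_sym ab leqnn /=.
have Nb_mem i : (a i \in N (b k) :\ a k) = (i < k).
  by rewrite !inE (inj_eq a_inj) e_sym ab ltn_neqAle.
have Nb_sub y : y \in N (b k) :\ a k -> exists i, y = a i.
  by rewrite !inE => /andP[_ /bN].
case: (posnP k) => [k0 | k_gt0].
  suff -> : N (b k) :\ a k = set0 by [].
  by apply/eqP/set0Pn=> -[y /[dup]/Nb_sub[i ->]]; rewrite Nb_mem k0.
have k1n : k.-1 < n by apply: leq_ltn_trans (leq_pred k) (ltn_ord k).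
have le_pred (i : 'I_n) : (i <= Ordinal k1n) = (i < k).
  by rewrite -ltnS prednK.
suff -> : N (b k) :\ a k = N (b (Ordinal k1n)) by apply: nbhd_in_system.
apply/setP=> y; apply/idP/idP => [/[dup]/Nb_sub[i ->]|].
  by rewrite Nb_mem inE e_sym ab le_pred.
by rewrite in_nbhd => /[dup]/bN[i ->]; rewrite Nb_mem e_sym ab le_pred.
Qed.

Lemma union_labelled : union_of_half_graphs_and_isolated e -> all_labelled.
Proof.
case=> P [I [[part _] half sep [/set0Pn[z0 z0I] iso]]] x xI.
have N0 : set0 \in NS.
  by have /eqP/cards0_eq <- := iso _ z0I; apply: nbhd_in_system.
have [/eqP covP _ _] := and3P part.
have block y : ~~ isolated e y -> exists2 S, S \in P & y \in S.
  move=> yI; have : y \in cover P by rewrite covP inE; apply: contra yI => /iso.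
  by case/bigcupP=> S; exists S.
have [S SP xS] := block x xI.
have NS_sub y z : y \in S -> e y z -> z \in S.
  move=> yS yz; have zI : ~~ isolated e z.
    by apply: (adj_nonisolated (y := y)); rewrite e_sym.
  have [S' S'P zS'] := block z zI.
  have [-> //|SS'] := eqVneq S S'.
  by have:= sep _ _ SP S'P SS' _ _ yS zS'; rewrite yz.
have [n [_ [a [b [[a_inj b_inj] _ defS [aa bb] ab]]]]] := half S SP.
have aS i : a i \in S by rewrite defS inE imset_f.
have bS i : b i \in S by rewrite defS inE imset_f ?orbT.
have inS y : y \in S -> (exists i, y = a i) \/ (exists i, y = b i).
  by rewrite defS inE => /orP[]/imsetP[i _ ->]; [left|right]; exists i.
have aN i y : e (a i) y -> exists j, y = b j.
  move=> ay; case/inS: (NS_sub _ _ (aS i) ay) => // -[j yj].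
  by have:= aa i j; rewrite -yj ay.
have bN i y : e (b i) y -> exists j, y = a j.
  move=> iy; case/inS: (NS_sub _ _ (bS i) iy) => // -[j yj].
  by have:= bb i j; rewrite -yj iy.
case/inS: xS => -[k ->]; first exact: half_graph_label ab.
(* For a vertex [b k] the roles of [a] and [b] are exchanged, which swaps the orientations. *)
apply: half_graph_label aN _ => //.
by case: ab => ab; [right|left] => i j; rewrite e_sym ab.
Qed.

End Graph.

Theorem theorem5p7 (T : finType) (e : rel T)
    (T_nonempty : 0 < #|T|) (e_sym : symmetric e) (e_loopless : irreflexive e) :
  well_graded (nbhd_system e) <->
  nonempty_set_of_isolated e [set: T] \/ union_of_half_graphs_and_isolated e.
Proof.
split=> [wg|H].
  exact/labelled_union/T_nonempty/well_graded_labelled.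
apply: labelled_well_graded => //.
(* If all vertices are isolated, [all_labelled] holds vacuously. *)
case: H => [[_ iso] x|]; first by rewrite iso ?inE.
exact: union_labelled.
Qed.
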